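(* Let $m\le n$ and equip $M_+(n,m)$ with the Riemannian metric $\langle u,v\rangle_a=\operatorname{tr}(u(a^Ta)^{-1}v^T)\sqrt{\det(a^Ta)}$. The sectional curvature of $M_+(n,m)$ at $a$ is given by \begin{align*} \frac{4\mathcal K_a(u, v)}{\sqrt{\det(a^Ta)}} = {}& \frac{4\langle R_a(u,v)v,u\rangle_a}{\sqrt{\det(a^Ta)}}\\ = {}& 2\operatorname{tr}([V_0,U_0][V_0^T,U_0])+ 2\operatorname{tr}([V_0,U_0^T][V_0,U_0]) + 2\operatorname{tr}(V_0U_0V_0^TU_0^T)\\ & + \operatorname{tr}(V_0V_0^TU_0^TU_0) - 4\operatorname{tr}(V_0V_0U_0^TU_0^T) + 4\operatorname{tr}(V_0U_0^TU_0V_0^T) \\ & + \operatorname{tr}(V_0^TV_0U_0U_0^T) - 2\operatorname{tr}(V_0V_0^TU_0U_0^T) - 2\operatorname{tr}(V_0U_0^TV_0U_0^T)\\ & + 6\operatorname{tr}(V_0U_0^TV_0U_0^Taa^+) - 3\operatorname{tr}(V_0U_0^TU_0V_0^Taa^+) - 3\operatorname{tr}(U_0V_0^TV_0U_0^Taa^+) \\ & - m\operatorname{tr}(V_0V_0^T)\operatorname{tr}(U_0U_0^T) + m(\operatorname{tr}(U_0V_0^T))^2 , \end{align*} where $u,v\in T_aM_+(n,m)$ are orthonormal with respect to this metric, and $U_0,V_0$ are the traceless parts of $U=ua^+$ and $V=va^+$, respectively. Furthermore: (1) If one of the tangent vectors $u,v$ is a pure trace direction, then the sectional curvature is zero. (2)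 If $m\ge 2$ and $u,v\in T_aM_+(n,m)$ are such that $U=ua^+$ and $V=va^+$ are symmetric (i.e., for tangent vectors that are horizontal with respect to the projection $\pi:M_+(n,m)\to\operatorname{Sym}_+(m)$, $\pi(a)=a^Ta$), then the sectional curvature is negative. (3) If $m=1$, then all sectional curvatures are non-negative, and they vanish identically for $n=m+1=2$. (4) If $m\in\{2,3\}$ and $n\ge m+2$, then the sectional curvature always admits both signs.
   Context: $M_+(n,m)$ is the set of real $n\times m$ matrices of rank $m$, an open subset of the vector space $M(n,m)$ of all real $n\times m$ matrices, so $T_aM_+(n,m)=M(n,m)$. $\operatorname{Sym}_+(m)$ is the space of positive definite symmetric $m\times m$ matrices. For $a\in M_+(n,m)$, $a^+=(a^Ta)^{-1}a^T$ is the Moore-Penrose inverse. For $u\in T_aM_+(n,m)$ and $U=ua^+\in M(n,n)$, the traceless part of $U$ is $U_0=U-\frac{\operatorname{tr}(U)}{m}aa^+$; correspondingly $u$ splits as $u=u_0+\frac{\operatorname{tr}(ua^+)}{m}a$, with traceless part $u_0$ and pure trace part $\frac{\operatorname{tr}(ua^+)}{m}a$, so a pure trace direction is a real multiple of $a$. $R$ is the Riemannian curvature tensor, with sign convention such that $\mathcal K_a(u,v)=\langle R_a(u,v)v,u\rangle_a$ is the sectional curvature for orthonormal $u,v$; $[A,B]=AB-BA$.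
   Formalization: In (2), the sectional curvature is shown to be non-positive for all symmetric U, V, and strictly negative when the plane of u, v does not contain the pure trace direction a; by (1) planes containing a have zero curvature, so (2) as stated fails for them. *)

(* Defs.v *)
From HB Require Import structures.
From mathcomp Require Import all_boot all_order all_algebra.
From mathcomp Require Import all_classical all_reals all_analysis.

Set Implicit Arguments.
Unset Strict Implicit.
Unset Printing Implicit Defensive.

Import Order.TTheory GRing.Theory Num.Theory.
Import numFieldNormedType.Exports.

Local Open Scope classical_set_scope.
Local Open Scope ring_scope.

(* Riemannian geometry of an open subset of a vector space V, whose tangent
   spaces are all identified with V.  A metric is a map g with
   g a u v = <u, v>_a.  Only its values near a matter for what is defined at a,
   so g may take arbitrary values outside of the open subset. *)
Section RiemannianGeometry.
Context {R : realType} {V : normedModType R}.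
Variable g : V -> V -> V -> R.

(* The pointwise part G of a connection D_X Y + G (X, Y) that is torsion-free
   and metric.  If g is a smooth Riemannian metric near a and V is
   finite-dimensional, such a G exists, is unique and is bilinear: it is the
   Levi-Civita connection. *)
Definition is_christoffel (a : V) (G : V -> V -> V) : Prop :=
  (forall u v, G u v = G v u) /\
  (forall u v w,
     'D_w (fun b => g b u v) a = g a (G w u) v + g a u (G w v)).

Definition christoffel (a : V) : V -> V -> V :=
  xget (fun _ _ => 0) (is_christoffel a).

Definition nabla (X Y : V -> V) : V -> V :=
  fun a => 'D_(X a) Y a + christoffel a (X a) (Y a).

Definition lie_bracket (X Y : V -> V) : V -> V :=
  fun a => 'D_(X a) Y a - 'D_(Y a) X a.

Definition riemann (X Y Z : V -> V) : V -> V :=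
  fun a => nabla X (nabla Y Z) a - nabla Y (nabla X Z) a
           - nabla (lie_bracket X Y) Z a.

(* R_a(u, v) w; by tensoriality any extension of u, v, w to vector fields may
   be used, and the constant ones are chosen. *)
Definition curvature (a u v w : V) : V :=
  riemann (fun _ => u) (fun _ => v) (fun _ => w) a.

Definition sectional_curvature (a u v : V) : R :=
  g a (curvature a u v v) u / (g a u u * g a v v - g a u v ^+ 2).

Definition orthonormal_pair (a u v : V) : Prop :=
  [/\ g a u u = 1, g a v v = 1 & g a u v = 0].

End RiemannianGeometry.

Section FullRankMatrices.
Context {R : realType} {n m : nat}.
Implicit Types a u v w : 'M[R]_(n, m).

Definition Mplus : set 'M[R]_(n, m) := [set a | \rank a = m].

Definition gram a : 'M[R]_m := a^T *m a.

Definition vol a : R := Num.sqrt (\det (gram a)).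

Definition metric a u v : R := \tr (u *m invmx (gram a) *m v^T) * vol a.

(* The Moore-Penrose inverse of a in Mplus (mathcomp's pinvmx is only some
   generalised inverse). *)
Definition mpinv a : 'M[R]_(m, n) := invmx (gram a) *m a^T.

Definition traceless a (U : 'M[R]_n) : 'M[R]_n :=
  U - (\tr U / m%:R) *: (a *m mpinv a).

Definition pure_trace a u : Prop := exists c : R, u = c *: a.

(* Orthogonal to the fibres of the projection gram : a |-> a^T a. *)
Definition horizontal a u : Prop :=
  forall w, 'D_w gram a = 0 -> metric a u w = 0.

End FullRankMatrices.

Definition mxcomm {R : realType} {n : nat} (A B : 'M[R]_n) : 'M[R]_n :=
  A *m B - B *m A.

(* Main.v *)
Require Import Defs.
From mathcomp Require Import all_boot all_order all_fingroup all_algebra.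
From mathcomp Require Import ring lra.
From mathcomp Require Import all_classical all_reals all_analysis.

Set Implicit Arguments.
Unset Strict Implicit.
Unset Printing Implicit Defensive.

Import Order.TTheory GRing.Theory Num.Theory.
Import numFieldNormedType.Exports.

Local Open Scope classical_set_scope.
Local Open Scope ring_scope.

(** For a tangent vector u at a put U = u a^+, and let P = a a^+, the orthogonal
    projection onto the column space of a. Then U P = U and u = U a, and every
    object of the statement becomes an expression in square matrices: the metric
    is vol a times tr(U V^T), and in a direction w, with W = w a^+, the volume has
    derivative vol a times tr W and b |-> u b^+ has derivative U W^T (1 - P) - U W.

    With these derivatives the Koszul formula can be solved explicitly. The
    Christoffel form G of the Levi-Civita connection is given by
      2 G(u, v) a^+ = tr(U) V + tr(V) U - tr(U V^T) P - V U - U V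
                      - (V U^T + U V^T) P + U^T V + V^T U,
    and it is the only solution because the metric is nondegenerate
    ([christoffelE]). The matrices of full rank form an open set, so the formula
    holds around a and may be differentiated, which writes <R(u, v)v, u> as vol a
    times the trace of a noncommutative polynomial in U, V, their transposes and P,
    with traces among its coefficients ([metric_curvature]).

    Comparing that trace with the claimed expression in the traceless parts only
    uses that the trace is linear and invariant under rotation and transposition of
    a product, together with P^T = P = P^2, U P = U, V P = V, tr P = m. This is a
    word problem, which a normalisation procedure on words, proved correct once and
    for all, reduces to a commutative identity ([mxtrace_mexp], [curvature_traceE]).
    The resulting formula holds for all u and v, orthonormal or not; hence the sign
    of the sectional curvature of any plane is the sign of the quartic expression
    [curvature_form] in U0 and V0, the denominator being positive by the strict
    Cauchy-Schwarz inequality.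

    The four sign statements are then read off that expression.
    - A pure trace direction has traceless part 0, and every term contains both U0
      and V0.
    - For symmetric U0 and V0 it equals 7 tr([V0, U0]^2) minus
      m (|U0|^2 |V0|^2 - <U0, V0>^2). The commutator of symmetric matrices is
      antisymmetric, so the square has nonpositive trace, and Cauchy-Schwarz makes
      the second part negative unless U0 and V0 are dependent, that is, unless the
      plane contains a.
    - If U0 = x q and V0 = y q with columns x and y orthogonal to the column space
      of a and a common row q, it equals
      (4 - m) |q|^4 (|x|^2 |y|^2 - <x, y>^2) ([curvature_form_rank1]). For m = 1
      all traceless parts have this shape, and for n = 2 the columns x and y are
      both orthogonal to a line of the plane, hence dependent. For m = 2, 3 and
      n >= m + 2 there is room for two independent columns, which gives positive
      curvature; negative curvature comes from the symmetric case. *)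

(** * Traces of words in matrices *)

(** LP stands for an orthogonal projection P, LX i for the i-th of finitely many
    matrices X with X P = X, and LXt i for its transpose. *)
Inductive letter := LP | LX of nat | LXt of nat.

Definition tr_letter (x : letter) : letter :=
  match x with LP => LP | LX i => LXt i | LXt i => LX i end.

(** The order serves to choose one word among those that have the same trace. *)
Definition letter_leb (x y : letter) : bool :=
  match x, y with
  | LP, _ => true
  | _, LP => false
  | LX i, LX j | LX i, LXt j | LXt i, LXt j => Nat.leb i j
  | LXt i, LX j => negb (Nat.leb j i)
  end.

Fixpoint word_leb (v w : seq letter) : bool :=
  match v, w with
  | [::], _ => true
  | _, [::] => false
  | x :: v', y :: w' =>
      if letter_leb x y then (if letter_leb y x then word_leb v' w' else true)
      else false
  end.

Definition cons_absorb (x : letter) (w : seq letter) : seq letter :=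
  match x, w with
  | LP, (LP | LXt _) :: _ => w
  | LX _, LP :: w' => x :: w'
  | _, _ => x :: w
  end.

Fixpoint absorb (w : seq letter) : seq letter :=
  match w with [::] => [::] | x :: w' => cons_absorb x (absorb w') end.

Definition rot_word (w : seq letter) : seq letter :=
  match w with [::] => [::] | x :: w' => w' ++ [:: x] end.

Fixpoint tr_word (w : seq letter) : seq letter :=
  match w with [::] => [::] | x :: w' => tr_word w' ++ [:: tr_letter x] end.

Definition least (v w : seq letter) := if word_leb v w then v else w.

(** The trace also identifies the two ends of a word, so P has to be absorbed across
    them as well; as in the next definition, the first argument only counts
    rotations. *)
Fixpoint cyc_absorb (k : seq letter) (w : seq letter) : seq letter :=
  match k with [::] => w | _ :: k' => cyc_absorb k' (absorb (rot_word w)) end.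

Fixpoint least_rot (k : seq letter) (w : seq letter) : seq letter :=
  match k with [::] => w | _ :: k' => least w (least_rot k' (rot_word w)) end.

(** The rotations of a word and those of its transpose all have the same trace, and
    the least of them represents the class. *)
Definition canon (w : seq letter) : seq letter :=
  let w := cyc_absorb w (absorb w) in
  least (least_rot w w) (least_rot w (tr_word w)).

(** Syntax of the matrix expressions whose traces are normalised; the scalars are
    kept as they are, so that they may themselves contain traces. *)
Inductive mexp (R : Type) :=
  | MLetter of letter
  | MOne
  | MAdd of mexp R & mexp R
  | MOpp of mexp R
  | MMul of mexp R & mexp R
  | MScale of R & mexp R
  | MTr of mexp R.

Section TraceWords.
Variables (R : comPzRingType) (n : nat) (P : 'M[R]_n) (Xs : seq 'M[R]_n).

Definition letter_mx (x : letter) : 'M[R]_n :=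
  match x with LP => P | LX i => nth P Xs i | LXt i => (nth P Xs i)^T end.

Fixpoint word_mx (w : seq letter) : 'M[R]_n :=
  match w with [::] => 1%:M | x :: w' => letter_mx x *m word_mx w' end.

Definition word_trace (w : seq letter) : R := \tr (word_mx w).

Fixpoint mexp_mx (e : mexp R) : 'M[R]_n :=
  match e with
  | MLetter x => letter_mx x
  | MOne => 1%:M
  | MAdd e f => mexp_mx e + mexp_mx f
  | MOpp e => - mexp_mx e
  | MMul e f => mexp_mx e *m mexp_mx f
  | MScale c e => c *: mexp_mx e
  | MTr e => (mexp_mx e)^T
  end.

Definition mono_mul (p q : R * seq letter) := (p.1 * q.1, p.2 ++ q.2).

Fixpoint monomials (e : mexp R) : seq (R * seq letter) :=
  match e with
  | MLetter x => [:: (1, [:: x])]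
  | MOne => [:: (1, [::])]
  | MAdd e f => monomials e ++ monomials f
  | MOpp e => map (fun p => (- p.1, p.2)) (monomials e)
  | MMul e f =>
      flatten (map (fun p => map (mono_mul p) (monomials f)) (monomials e))
  | MScale c e => map (fun p => (c * p.1, p.2)) (monomials e)
  | MTr e => map (fun p => (p.1, tr_word p.2)) (monomials e)
  end.

Definition trace_comb (s : seq (R * seq letter)) : R :=
  foldr (fun p t => p.1 * word_trace (canon p.2) + t) 0 s.

Hypotheses (trP : P^T = P) (PP : P *m P = P).
Hypothesis XP : {in Xs, forall X, X *m P = X}.

Lemma word_mx_cat v w : word_mx (v ++ w) = word_mx v *m word_mx w.
Proof. by elim: v => [|x v IH] /=; rewrite ?mul1mx // IH mulmxA. Qed.

Lemma letter_mx_tr x : letter_mx (tr_letter x) = (letter_mx x)^T.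
Proof. by case: x => [|i|i] /=; rewrite ?trP ?trmxK. Qed.

Lemma word_mx_tr w : word_mx (tr_word w) = (word_mx w)^T.
Proof.
elim: w => [|x w IH] /=; first by rewrite trmx1.
by rewrite word_mx_cat /= mulmx1 IH letter_mx_tr trmx_mul.
Qed.

Lemma word_trace_tr w : word_trace (tr_word w) = word_trace w.
Proof. by rewrite /word_trace word_mx_tr mxtrace_tr. Qed.

Lemma word_trace_rot w : word_trace (rot_word w) = word_trace w.
Proof.
case: w => //= x w; rewrite /word_trace word_mx_cat /= mulmx1.
exact: mxtrace_mulC.
Qed.

(** Transposing X P = X gives P X^T = X^T, which is why P disappears to the right of
    an X and to the left of an X^T. A default value P for the list of matrices keeps
    this true for every index. *)
Lemma word_mx_absorb w : word_mx (absorb w) = word_mx w.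
Proof.
have nthP i : nth P Xs i *m P = nth P Xs i.
  have [lti | lei] := ltnP i (size Xs); last by rewrite nth_default.
  exact/XP/mem_nth.
have Pnth i : P *m (nth P Xs i)^T = (nth P Xs i)^T.
  by rewrite -[in RHS]nthP trmx_mul trP.
elim: w => //= x w <-.
by case: x => [|i|i]; case: (absorb w) => [|[|j|j] w'] //=;
   rewrite mulmxA ?PP ?nthP ?Pnth.
Qed.

Lemma word_trace_absorb w : word_trace (absorb w) = word_trace w.
Proof. by rewrite /word_trace word_mx_absorb. Qed.

Lemma word_trace_canon w : word_trace (canon w) = word_trace w.
Proof.
have cycE k v : word_trace (cyc_absorb k v) = word_trace v.
  by elim: k v => //= _ k IH v; rewrite IH word_trace_absorb word_trace_rot.
have leastE v1 v2 : word_trace v1 = word_trace v2 ->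
    word_trace (least v1 v2) = word_trace v2 by rewrite /least; case: ifP.
have rotE k v : word_trace (least_rot k v) = word_trace v.
  elim: k v => //= _ k IH v; have E := IH (rot_word v).
  by rewrite leastE ?E ?word_trace_rot.
rewrite /canon; set w' := cyc_absorb _ _.
have -> : word_trace w = word_trace w' by rewrite cycE word_trace_absorb.
by rewrite leastE !rotE word_trace_tr.
Qed.

Definition mono_mx (p : R * seq letter) := p.1 *: word_mx p.2.

Lemma mexp_mxE e : mexp_mx e = \sum_(p <- monomials e) mono_mx p.
Proof.
elim: e => [x||e IHe f IHf|e IHe|e IHe f IHf|c e IHe|e IHe] /=.
- by rewrite big_seq1 /mono_mx scale1r /= mulmx1.
- by rewrite big_seq1 /mono_mx scale1r.
- by rewrite big_cat IHe IHf.
- rewrite big_map IHe -sumrN; apply: eq_bigr => p _.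
  by rewrite /mono_mx scaleNr.
- rewrite IHe IHf mulmx_suml big_flatten /= big_map; apply: eq_bigr => p _.
  rewrite mulmx_sumr big_map; apply: eq_bigr => q _.
  rewrite /mono_mx /= word_mx_cat -scalemxAl -scalemxAr scalerA.
  by rewrite mulrC.
- rewrite big_map IHe scaler_sumr; apply: eq_bigr => p _.
  by rewrite /mono_mx scalerA.
- rewrite big_map IHe linear_sum /=; apply: eq_bigr => p _.
  by rewrite /mono_mx /= word_mx_tr linearZ.
Qed.

(** The correctness of the normalisation. Both sides of a trace identity become
    combinations of traces of canonical words, and if the identity follows from
    the invariances of the trace it is now one between commutative polynomials in
    these traces. *)
Lemma mxtrace_mexp e : \tr (mexp_mx e) = trace_comb (monomials e).
Proof.
rewrite mexp_mxE linear_sum /= /trace_comb.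
elim: (monomials e) => [|p s IH]; first by rewrite big_nil.
by rewrite big_cons IH /= word_trace_canon /mono_mx linearZ.
Qed.

End TraceWords.

Ltac letter_index Xs X :=
  lazymatch Xs with
  | X :: _ => constr:(O)
  | _ :: ?Ys => let i := letter_index Ys X in constr:(S i)
  end.

Ltac reify_mx K P Xs t :=
  lazymatch t with
  | P => constr:(@MLetter K LP)
  | 1%:M => constr:(@MOne K)
  | GRing.add ?x ?y =>
      let e := reify_mx K P Xs x in let f := reify_mx K P Xs y in
      constr:(MAdd e f)
  | GRing.opp ?x => let e := reify_mx K P Xs x in constr:(MOpp e)
  | mulmx ?x ?y =>
      let e := reify_mx K P Xs x in let f := reify_mx K P Xs y in
      constr:(MMul e f)
  | GRing.scale ?c ?x => let e := reify_mx K P Xs x in constr:(MScale c e)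
  | trmx ?x => let e := reify_mx K P Xs x in constr:(MTr e)
  | _ => let i := letter_index Xs t in constr:(@MLetter K (LX i))
  end.

(** Normalises all traces of a goal and abstracts the function that gives the traces
    of words, which leaves a commutative identity. The hypotheses are P^T = P, P P = P
    and the list of matrices X with X P = X. The evaluation is restricted to the
    functions on words in order to keep the scalars intact. *)
Ltac trace_words trP PP XP :=
  lazymatch type of XP with
  | prop_in1 (mem ?Xs) _ =>
  lazymatch type of trP with ?P^T = _ =>
    repeat match goal with
    | |- context [mxtrace ?t] =>
        let K := type of (mxtrace t) in
        let e := reify_mx K P Xs t in
        let H := fresh in
        pose proof (mxtrace_mexp trP PP XP e) as H;
        change (mexp_mx P Xs e) with t in H;
        rewrite H; clear H
    end;
    cbv [trace_comb monomials mono_mul flatten map foldr cat fst snd tr_word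
         tr_letter canon cyc_absorb absorb cons_absorb rot_word least word_leb
         letter_leb least_rot Nat.leb negb];
    move: (word_trace P Xs)
  end end.

(** * The curvature expression *)

Section CurvatureForm.
Variables (R : realType) (n : nat).
Implicit Types P U V W : 'M[R]_n.

(** The solution of the Koszul formula, multiplied by a^+ on the right. *)
Definition lifted_christoffel P U V : 'M[R]_n :=
  2^-1 *: (\tr U *: V + \tr V *: U - \tr (U *m V^T) *: P - V *m U - U *m V
   - (V *m U^T + U *m V^T) *m P + U^T *m V + V^T *m U).

(** The derivative of b |-> u b^+ in the direction w, for U = u a^+ and W = w a^+. *)
Definition lift_diff P W U : 'M[R]_n := U *m W^T *m (1%:M - P) - U *m W.

(** The derivative in the direction w of the Christoffel form at (u, v), multiplied by
    a^+ on the right. It is not the derivative of [lifted_christoffel], since a^+ is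
    kept fixed when multiplying: the factor a of the form contributes W = w a^+, not
    the derivative of P. *)
Definition lifted_christoffel_diff P W U V : 'M[R]_n :=
  2^-1 *: (\tr (lift_diff P W U) *: V + \tr (lift_diff P W V) *: U
   - (\tr (lift_diff P W U *m V^T + U *m (lift_diff P W V)^T) *: P + \tr (U *m V^T) *: W)
   - lift_diff P W V *m U - lift_diff P W U *m V
   - ((lift_diff P W V *m U^T + V *m (lift_diff P W U)^T
       + (lift_diff P W U *m V^T + U *m (lift_diff P W V)^T)) *m P
       + (V *m U^T + U *m V^T) *m W)
   + (lift_diff P W U)^T *m V + (lift_diff P W V)^T *m U).

(** This is <R(u, v)v, u> up to the volume factor: the four terms come from
    R(u, v)v = D_u G(v, v) - D_v G(u, v) + G(u, G(v, v)) - G(v, G(u, v)), the bracket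
    of constant fields being 0. *)
Definition curvature_trace P U V : R :=
  \tr ((lifted_christoffel_diff P U V V - lifted_christoffel_diff P V U V
        + lifted_christoffel P U (lifted_christoffel P V V)
        - lifted_christoffel P V (lifted_christoffel P U V)) *m U^T).

Definition curvature_form (m : R) P U0 V0 : R :=
  2 * \tr (mxcomm V0 U0 *m mxcomm V0^T U0)
         + 2 * \tr (mxcomm V0 U0^T *m mxcomm V0 U0)
         + 2 * \tr (V0 *m U0 *m V0^T *m U0^T)
         + \tr (V0 *m V0^T *m U0^T *m U0)
         - 4 * \tr (V0 *m V0 *m U0^T *m U0^T)
         + 4 * \tr (V0 *m U0^T *m U0 *m V0^T)
         + \tr (V0^T *m V0 *m U0 *m U0^T)
         - 2 * \tr (V0 *m V0^T *m U0 *m U0^T)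
         - 2 * \tr (V0 *m U0^T *m V0 *m U0^T)
         + 6 * \tr (V0 *m U0^T *m V0 *m U0^T *m P)
         - 3 * \tr (V0 *m U0^T *m U0 *m V0^T *m P)
         - 3 * \tr (U0 *m V0^T *m V0 *m U0^T *m P)
         - m * \tr (V0 *m V0^T) * \tr (U0 *m U0^T)
         + m * \tr (U0 *m V0^T) ^+ 2.

(** The scalars x and y are introduced instead of tr(U) / m so that the identity is
    polynomial and holds for m = 0 too. *)
Lemma curvature_traceE m P U V x y :
  P^T = P -> P *m P = P -> U *m P = U -> V *m P = V ->
  \tr P = m -> \tr U = x * m -> \tr V = y * m ->
  4 * curvature_trace P U V = curvature_form m P (U - x *: P) (V - y *: P).
Proof.
move=> trP PP UP VP.
have XP : {in [:: U; V], forall X, X *m P = X}.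
  by move=> X; rewrite !inE => /orP[]/eqP->.
rewrite /curvature_form /mxcomm /curvature_trace.
rewrite /lifted_christoffel_diff /lifted_christoffel /lift_diff.
trace_words trP PP XP => T TP TU TV.
have {}TP : T [:: LP] = m by rewrite -TP mul1r addr0.
have {}TU : T [:: LX 0] = x * m by rewrite -TU mul1r addr0.
have {}TV : T [:: LX 1] = y * m by rewrite -TV mul1r addr0.
by rewrite TP TU TV; field; rewrite ?pnatr_eq0.
Qed.

(** Both sides are, up to the volume factor, the derivative of <u, v> in the direction
    w; this is the identity by which the connection is metric. *)
Lemma lifted_christoffel_compat P U V W :
  P^T = P -> P *m P = P -> U *m P = U -> V *m P = V -> W *m P = W ->
  \tr W * \tr (U *m V^T) - \tr (U *m (W + W^T) *m V^T) =
  \tr (lifted_christoffel P W U *m V^T) + \tr (U *m (lifted_christoffel P W V)^T).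
Proof.
move=> trP PP UP VP WP.
have XP : {in [:: U; V; W], forall X, X *m P = X}.
  by move=> X; rewrite !inE => /or3P[]/eqP->.
rewrite /lifted_christoffel.
by trace_words trP PP XP => T; field; rewrite ?pnatr_eq0.
Qed.

(** When U and V are symmetric only tr(U V U V) and tr(U U V V) survive, besides the
    quadratic traces, and the commutator squared accounts for both. *)
Lemma curvature_form_sym m P U V :
  P^T = P -> P *m P = P -> U *m P = U -> V *m P = V ->
  U^T = U -> V^T = V ->
  curvature_form m P U V = 7 * \tr (mxcomm V U *m mxcomm V U)
    - m * (\tr (U *m U) * \tr (V *m V) - \tr (U *m V) ^+ 2).
Proof.
move=> trP PP UP VP Us Vs.
have XP : {in [:: U; V], forall X, X *m P = X}.
  by move=> X; rewrite !inE => /orP[]/eqP->.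
rewrite /curvature_form /mxcomm Us Vs.
trace_words trP PP XP => T; ring.
Qed.
End CurvatureForm.

(** * Directional derivatives of matrix-valued maps *)

Section MatrixCalculus.
Context {R : realType} {V : normedModType R} (a v : V).

Lemma is_derive_ext {W : normedModType R} (f g : V -> W) df :
  f =1 g -> is_derive a v f df -> is_derive a v g df.
Proof. by move=> /funext ->. Qed.

Lemma is_derive_mxP m n (M : V -> 'M[R]_(m, n)) dM :
  is_derive a v M dM <->
  forall i j, is_derive a v (fun x => M x i j) (dM i j).
Proof.
split=> [dMa i j|dMa].
  have Mv : derivable M a v by [].
  have /derivable_mxP/(_ i j) Mij := Mv.
  apply: DeriveDef => //.
  by have <- := @derive_val _ _ _ _ _ _ _ dMa; rewrite derive_mx // mxE.
have Mv : derivable M a v by apply/derivable_mxP => i j; exact: ex_derive.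
apply: DeriveDef => //; rewrite derive_mx //.
by apply/matrixP => i j; rewrite mxE; exact: derive_val.
Qed.

Lemma is_derive_sum_seq (I : Type) (r : seq I) (h : I -> V -> R) (dh : I -> R) :
  (forall i, is_derive a v (h i) (dh i)) ->
  is_derive a v (fun x => \sum_(i <- r) h i x) (\sum_(i <- r) dh i).
Proof.
move=> hd; elim: r => [|i r IH].
  rewrite big_nil.
  by apply: is_derive_ext (is_derive_cst (0 : R) a v) => x; rewrite big_nil.
rewrite big_cons.
by apply: is_derive_ext (is_deriveD (hd i) IH) => x; rewrite big_cons.
Qed.

Lemma is_derive_mulr (f g : V -> R) df dg :
  is_derive a v f df -> is_derive a v g dg ->
  is_derive a v (fun x => f x * g x) (df * g a + f a * dg).
Proof.
move=> fd gd; apply: is_derive_eq (is_deriveM fd gd) _.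
by rewrite addrC mulrC.
Qed.

Lemma is_derive_prod (I : finType) (h : I -> V -> R) (dh : I -> R) :
  (forall i, is_derive a v (h i) (dh i)) ->
  is_derive a v (fun x => \prod_i h i x)
    (\sum_k \prod_i (if i == k then dh i else h i a)).
Proof.
move=> hd; move: (index_enum_uniq I); elim: (index_enum I) => [_|i r IH].
  rewrite big_nil.
  by apply: is_derive_ext (is_derive_cst (1 : R) a v) => x; rewrite big_nil.
move=> /= /andP[ir ur].
under eq_fun do rewrite big_cons.
apply: is_derive_eq (is_derive_mulr (hd i) (IH ur)) _.
rewrite big_cons big_cons eqxx; congr (_ * _ + _).
  by apply: eq_big_seq => k kr; case: eqP => // ki; rewrite -ki kr in ir.
rewrite mulr_sumr; apply: eq_big_seq => k kr; rewrite big_cons.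
by case: eqP => // ki; rewrite ki kr in ir.
Qed.

Lemma is_derive_mulmx m n p (M : V -> 'M[R]_(m, n)) (N : V -> 'M[R]_(n, p)) dM dN :
  is_derive a v M dM -> is_derive a v N dN ->
  is_derive a v (fun x => M x *m N x) (dM *m N a + M a *m dN).
Proof.
move=> /is_derive_mxP Md /is_derive_mxP Nd; apply/is_derive_mxP => i j.
have H := is_derive_sum_seq (index_enum _) (fun k => is_derive_mulr (Md i k) (Nd k j)).
rewrite !mxE -big_split /=.
by apply: is_derive_ext H => x; rewrite mxE.
Qed.

Lemma is_derive_trmx m n (M : V -> 'M[R]_(m, n)) dM :
  is_derive a v M dM -> is_derive a v (fun x => (M x)^T) dM^T.
Proof.
move=> /is_derive_mxP Md; apply/is_derive_mxP => i j; rewrite mxE.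
by apply: is_derive_ext (Md j i) => x; rewrite mxE.
Qed.

Lemma is_derive_mxtrace n (M : V -> 'M[R]_n) dM :
  is_derive a v M dM -> is_derive a v (fun x => \tr (M x)) (\tr dM).
Proof. by move=> /is_derive_mxP Md; apply: is_derive_sum_seq. Qed.

Lemma is_derive_scalemx m n (f : V -> R) (M : V -> 'M[R]_(m, n)) df dM :
  is_derive a v f df -> is_derive a v M dM ->
  is_derive a v (fun x => f x *: M x) (df *: M a + f a *: dM).
Proof.
move=> fd /is_derive_mxP Md; apply/is_derive_mxP => i j.
rewrite !mxE.
by apply: is_derive_ext (is_derive_mulr fd (Md i j)) => x; rewrite mxE.
Qed.

(** Jacobi's formula. By the product rule the derivative is the sum over k of the
    determinants in which row k is replaced by its derivative; such a determinant is
    expanded along that row, whose cofactors are those of the original matrix. *)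
Lemma is_derive_det n (M : V -> 'M[R]_n) dM :
  is_derive a v M dM ->
  is_derive a v (fun x => \det (M x)) (\tr (dM *m \adj (M a))).
Proof.
move=> /is_derive_mxP Md.
have H (s : 'S_n) : is_derive a v (fun x => (-1) ^+ s * \prod_i M x i (s i))
    ((-1) ^+ s * \sum_k \prod_i (if i == k then dM i (s i) else M a i (s i))).
  have := is_derive_mulr (is_derive_cst ((-1) ^+ s : R) a v)
            (is_derive_prod (fun i => Md i (s i))).
  by rewrite mul0r add0r.
apply: is_derive_eq (is_derive_sum_seq _ H) _.
under eq_bigr do rewrite mulr_sumr.
rewrite exchange_big; apply: eq_bigr => k _ /=.
pose B := \matrix_(i, j) (if i == k then dM i j else M a i j).
rewrite [LHS](_ : _ = \det B); last first.
  by apply: eq_bigr => s _; congr (_ * _); apply: eq_bigr => i _; rewrite mxE.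
rewrite (expand_det_row _ k) mxE; apply: eq_bigr => j _.
rewrite !mxE eqxx; congr (_ * (_ * \det _)).
apply/matrixP => i' j'; rewrite !mxE.
by rewrite eq_sym (negPf (neq_lift _ _)).
Qed.

(** Cofactors and the inverse of the determinant show that the inverse is
    differentiable; its derivative is then forced by differentiating the constant
    product of the matrix and its inverse. *)
Lemma is_derive_invmx n (M : V -> 'M[R]_n) dM :
  (\forall x \near a, M x \in unitmx) -> is_derive a v M dM ->
  is_derive a v (fun x => invmx (M x)) (- (invmx (M a) *m dM *m invmx (M a))).
Proof.
move=> Mu Md; have Mau : M a \in unitmx by exact: nbhs_singleton Mu.
have Ma0 : \det (M a) != 0 by rewrite -unitfE -unitmxE.
have [dN Nd] : exists dN, is_derive a v (fun x => invmx (M x)) dN.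
  have adjd : derivable (fun x => \adj (M x)) a v.
    apply/derivable_mxP => i j.
    have : is_derive a v (fun x => row' j (col' i (M x))) (row' j (col' i dM)).
      apply/is_derive_mxP => k l; rewrite !mxE.
      move/is_derive_mxP: Md => /(_ (lift j k) (lift i l)).
      by apply: is_derive_ext => x; rewrite !mxE.
    move=> /is_derive_det /(is_derive_mulr (is_derive_cst ((-1) ^+ (j + i) : R) a v)) H.
    rewrite (_ : (fun x => _) =
                 fun x => (-1) ^+ (j + i) * \det (row' j (col' i (M x)))).
      exact: ex_derive.
    by apply/funext => x; rewrite mxE.
  have detd : derivable (fun x => (\det (M x))^-1) a v.
    by apply: derivableV => //; case: (is_derive_det Md).
  have := is_derive_scalemx (derivableP detd) (derivableP adjd).
  set dN := (X in is_derive _ _ _ X) => H; exists dN.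
  apply: near_eq_is_derive H; near do rewrite /invmx ifT //.
  by apply: filterS Mu.
have : is_derive a v (fun x => M x *m invmx (M x)) 0.
  apply: near_eq_is_derive (is_derive_cst 1%:M a v).
  by apply: filterS Mu => x Mx; rewrite mulmxV.
have /[swap] E0 := is_derive_mulmx Md Nd.
move=> E1; have := @derive_val _ _ _ _ _ _ _ E1.
rewrite (@derive_val _ _ _ _ _ _ _ E0) => /esym/eqP; rewrite addrC addr_eq0 => /eqP E.
apply: is_derive_eq Nd _.
by rewrite -[LHS](mulKmx Mau) E mulmxN mulmxA.
Unshelve. all: by end_near. Qed.

(** Restricting to a line makes the one-variable chain rule available. *)
Lemma derive_line (f : V -> R) : 'D_v f a = 'D_1 (fun t : R => f (t *: v + a)) 0.
Proof.
apply: (congr1 (fun g : R -> R => lim (g @ 0^'))); apply/funext => h /=.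
by rewrite addr0 scale0r add0r [_ *: 1]mulr1.
Qed.

Lemma is_derive_sqrt (f : V -> R) df : 0 < f a -> is_derive a v f df ->
  is_derive a v (fun x => Num.sqrt (f x)) (df / (2 * Num.sqrt (f a))).
Proof.
move=> fa0 [fv <-].
have line := derivableP ((derivable1P _ _ _).1 fv).
have f0 : 0 < f (0 *: v + a) by rewrite scale0r add0r.
have [cv cE] := is_derive1_comp (is_derive1_sqrt f0) line.
apply: DeriveDef; first exact: (derivable1P _ _ _).2 cv.
by rewrite !derive_line [LHS]cE scale0r add0r mulrC.
Qed.

End MatrixCalculus.

(** * The Frobenius scalar product *)

Section Frobenius.
Context {R : realType} {m n : nat}.
Implicit Types A B : 'M[R]_(m, n).

Lemma mxtrace_mul_tr A B : \tr (A *m B^T) = \sum_i \sum_j A i j * B i j.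
Proof.
by apply: eq_bigr => i _; rewrite mxE; apply: eq_bigr => j _; rewrite mxE.
Qed.

Lemma mxtrace_trC A B : \tr (A *m B^T) = \tr (B *m A^T).
Proof. by rewrite -mxtrace_tr trmx_mul trmxK. Qed.

Lemma frob_ge0 A : 0 <= \tr (A *m A^T).
Proof.
rewrite mxtrace_mul_tr; do 2!apply: sumr_ge0 => ? _.
by rewrite -expr2 sqr_ge0.
Qed.

Lemma frob_eq0 A : \tr (A *m A^T) = 0 -> A = 0.
Proof.
rewrite mxtrace_mul_tr => /eqP; rewrite psumr_eq0; last first.
  by move=> i _; apply: sumr_ge0 => j _; rewrite -expr2 sqr_ge0.
move=> /allP A0; apply/matrixP => i j; rewrite mxE.
have /= := A0 i (mem_index_enum i); rewrite psumr_eq0; last first.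
  by move=> k _; rewrite -expr2 sqr_ge0.
by move=> /allP/(_ j (mem_index_enum j)) /=; rewrite mulf_eq0 orbb => /eqP.
Qed.

Lemma frob_gt0 A : A != 0 -> 0 < \tr (A *m A^T).
Proof.
move=> A0; rewrite lt_def frob_ge0 andbT.
by apply: contra_neq A0; exact: frob_eq0.
Qed.

Lemma frob_comb A B (x y : R) :
  \tr ((x *: A + y *: B) *m (x *: A + y *: B)^T) =
  x ^+ 2 * \tr (A *m A^T) + 2 * x * y * \tr (A *m B^T) + y ^+ 2 * \tr (B *m B^T).
Proof.
rewrite [(_ + _)^T]linearD /= ![(_ *: _)^T]linearZ /=.
rewrite mulmxDl !mulmxDr -!scalemxAl -!scalemxAr !(mxtraceD, mxtraceZ).
by rewrite (mxtrace_trC B A); ring.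
Qed.

(** The matrix C is |B|^2 times the component of A orthogonal to B. Its norm is
    nonnegative, and it vanishes only if A and B are dependent, which gives the
    Cauchy-Schwarz inequality and its equality case at once. *)
Lemma frob_residual A B :
  let C := \tr (B *m B^T) *: A + - \tr (A *m B^T) *: B in
  \tr (C *m C^T) = \tr (B *m B^T) *
    (\tr (A *m A^T) * \tr (B *m B^T) - \tr (A *m B^T) ^+ 2).
Proof. by rewrite /= frob_comb; ring. Qed.

Lemma frob_CauchySchwarz A B :
  \tr (A *m B^T) ^+ 2 <= \tr (A *m A^T) * \tr (B *m B^T).
Proof.
have [->|B0] := eqVneq B 0.
  by rewrite trmx0 !mulmx0 mxtrace0 mulr0 expr0n.
rewrite -subr_ge0 -(pmulr_rge0 _ (frob_gt0 B0)) -frob_residual.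
exact: frob_ge0.
Qed.

Lemma frob_CauchySchwarz_lt A B :
  (forall x y, x *: A + y *: B = 0 -> x = 0 /\ y = 0) ->
  \tr (A *m B^T) ^+ 2 < \tr (A *m A^T) * \tr (B *m B^T).
Proof.
move=> indep.
have B0 : B != 0.
  apply/eqP => B0; have [] := indep 0 1.
    by rewrite B0 scale0r scaler0 addr0.
  by move=> _ /eqP; rewrite oner_eq0.
have Bgt0 := frob_gt0 B0.
rewrite -subr_gt0 -(pmulr_rgt0 _ Bgt0) -frob_residual.
apply: frob_gt0; apply/eqP => /indep[E _].
by move: Bgt0; rewrite E ltxx.
Qed.
End Frobenius.

Lemma mxtrace_sqr_antisym (R : realType) n (C : 'M[R]_n) :
  C^T = - C -> \tr (C *m C) <= 0.
Proof.
move=> CT; have := frob_ge0 C.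
by rewrite CT mulmxN linearN /= oppr_ge0.
Qed.

(** * Matrices of full rank *)

Section MatrixContinuity.
Context {R : realType} {T : topologicalType}.

Lemma continuous_mulmx_entry m n p (M : T -> 'M[R]_(m, n)) (N : T -> 'M[R]_(n, p)) i j :
  (forall k, continuous (fun x => M x i k)) ->
  (forall k, continuous (fun x => N x k j)) ->
  continuous (fun x => (M x *m N x) i j).
Proof.
move=> Mc Nc; under eq_fun do rewrite mxE.
apply: (continuous_big (P := xpredT) add_continuous) => k _ x.
by apply: cvgM; [exact: Mc | exact: Nc].
Qed.

Lemma continuous_det n (M : T -> 'M[R]_n) :
  (forall i j, continuous (fun x => M x i j)) ->
  continuous (fun x => \det (M x)).
Proof.
move=> Mc; apply: (continuous_big (P := xpredT) add_continuous) => s _ x.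
apply: cvgM; first exact: cvg_cst.
exact: (continuous_big (P := xpredT) mul_continuous).
Qed.

Lemma near_gt0 (f : T -> R) (Q : set T) x :
  continuous f -> 0 < f x -> (forall y, 0 < f y -> Q y) ->
  \forall y \near x, Q y.
Proof.
move=> fc fx0 fQ; have H : \forall y \near x, 0 < f y by exact: cvgr_gt (fc x) _ fx0.
by apply: filterS H => y; exact: fQ.
Qed.
End MatrixContinuity.

Section FullRank.
Context {R : realType} {n m : nat}.
Implicit Types a u v w : 'M[R]_(n, m).

Lemma gram_sym a : (gram a)^T = gram a.
Proof. by rewrite /gram trmx_mul trmxK. Qed.

(** On the segment from the identity to the Gram matrix all matrices are positive
    definite, hence invertible: a kernel vector k satisfies
    t |k a^T|^2 + (1 - t) |k|^2 = 0. *)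
Lemma gram_interp_unit a (t : R) : Mplus a -> 0 <= t <= 1 ->
  t *: gram a + (1 - t)%:M \in unitmx.
Proof.
move=> ra /andP[t0 t1]; rewrite -row_free_unit -kermx_eq0.
set G := _ + _; move: (kermx G) (mulmx_ker G) => K KG.
have E : t * \tr ((K *m a^T) *m (K *m a^T)^T) + (1 - t) * \tr (K *m K^T) = 0.
  have := congr1 (fun M => \tr (M *m K^T)) KG.
  rewrite /G mulmxDr mul_mx_scalar -scalemxAr mulmxDl -!scalemxAl linearD /= !linearZ /=.
  by rewrite mul0mx mxtrace0 /gram trmx_mul trmxK !mulmxA.
have Ka0 := frob_ge0 (K *m a^T); have K0 := frob_ge0 K.
have [t00|tn0] := eqVneq t 0.
  by apply/eqP/frob_eq0; move: E; rewrite t00 mul0r subr0 mul1r add0r.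
have aT_free : row_free a^T by rewrite /row_free mxrank_tr ra.
have /frob_eq0/eqP : \tr ((K *m a^T) *m (K *m a^T)^T) = 0 by nra.
by rewrite mulmx_free_eq0.
Qed.

(** The determinant along the previous segment is a polynomial in t that is 1 at t = 0
    and has no root in [0, 1], so it is positive at t = 1. *)
Lemma det_gram_gt0 a : Mplus a -> 0 < \det (gram a).
Proof.
move=> ra; rewrite ltNge; apply/negP => det_le0.
pose Gx : 'M[{poly R}]_m := 'X *: map_mx polyC (gram a) + (1 - 'X)%:M.
have hornerG t : (\det Gx).[t] = \det (t *: gram a + (1 - t)%:M).
  rewrite -horner_evalE -det_map_mx; congr (\det _); apply/matrixP => i j.
  by rewrite !mxE /= horner_evalE hornerD hornerM hornerX hornerC hornerMn !hornerE.
have [t t01 /rootP] : exists2 t, 0 <= t <= 1 & root (- \det Gx) t.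
  apply: poly_ivt; first exact: ler01.
  rewrite !hornerE !hornerG scale0r add0r subr0 det1 subrr scale1r raddf0 addr0.
  by rewrite oppr_le0 ler01 oppr_ge0.
rewrite hornerN hornerG => /eqP; rewrite oppr_eq0 => /eqP det0.
by have := gram_interp_unit ra t01; rewrite unitmxE det0 unitr0.
Qed.

Lemma gram_unit a : Mplus a -> gram a \in unitmx.
Proof. by move=> /det_gram_gt0 d0; rewrite unitmxE unitfE gt_eqF. Qed.

Lemma vol_gt0 a : Mplus a -> 0 < vol a.
Proof. by move=> /det_gram_gt0; rewrite /vol sqrtr_gt0. Qed.

Lemma Mplus_gram a : gram a \in unitmx -> Mplus a.
Proof.
move=> Gu; rewrite /Mplus /=; apply/eqP; rewrite eqn_leq rank_leq_col /=.
by rewrite -{1}(mxrank_unit Gu) mxrankM_maxr.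
Qed.

Lemma det_gram_continuous : continuous (fun a => \det (gram a)).
Proof.
apply: continuous_det => i j.
rewrite (_ : (fun a => _) = (fun a => (a^T *m a) i j)) //.
apply: continuous_mulmx_entry => [k|k]; last exact: coord_continuous.
under eq_fun do rewrite mxE; exact: coord_continuous.
Qed.

(** Having full rank is an open condition, as it amounts to a nonzero determinant of
    the Gram matrix. *)
Lemma near_Mplus a (Q : set 'M[R]_(n, m)) :
  Mplus a -> (forall b, Mplus b -> Q b) -> \forall b \near a, Q b.
Proof.
move=> /det_gram_gt0 d0 MQ.
apply: (near_gt0 det_gram_continuous d0) => b db; apply/MQ/Mplus_gram.
by rewrite unitmxE unitfE gt_eqF.
Qed.
End FullRank.

(** * The metric in terms of the Moore-Penrose inverse *)

(* The identities of this section hold for any p in place of the Moore-Penrose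
   inverse. Keeping p a variable prevents its definition from being unfolded when
   products are reassociated. *)
Section Variations.
Context {R : realType} {n m : nat}.
Implicit Types (u v w a : 'M[R]_(n, m)) (p : 'M[R]_(m, n)).

Lemma mulmx_mul_tr u v p : (u *m p) *m (v *m p)^T = u *m (p *m p^T) *m v^T.
Proof. by rewrite trmx_mul !mulmxA. Qed.

Lemma lift_variation u w a p :
  u *m (p *m p^T *m w^T *m (1%:M - a *m p) - p *m w *m p) =
  lift_diff (a *m p) (w *m p) (u *m p).
Proof. by rewrite /lift_diff trmx_mul mulmxBr !mulmxA. Qed.

Lemma metric_variation u v w a p :
  u *m (p *m p^T *m (w^T *m a + a^T *m w) *m (p *m p^T)) *m v^T =
  (u *m p) *m (w *m p)^T *m ((v *m p) *m (a *m p)^T)^T +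
  (u *m p *m (a *m p)^T) *m (w *m p) *m (v *m p)^T.
Proof. by rewrite !trmx_mul !trmxK !(mulmxDr, mulmxDl, mulmxA). Qed.

Lemma gram_variation w a p :
  (w *m p)^T *m (a *m p) + (a *m p)^T *m (w *m p) =
  p^T *m (w^T *m a + a^T *m w) *m p.
Proof. by rewrite !trmx_mul !(mulmxDr, mulmxDl, mulmxA). Qed.
End Variations.

Section MoorePenrose.
Context {R : realType} {n m : nat} (a : 'M[R]_(n, m)) (ra : Mplus a).
Implicit Types u v w : 'M[R]_(n, m).
Local Notation p := (mpinv a).
Local Notation P := (a *m p).

Lemma mpinvK : p *m a = 1%:M.
Proof. by rewrite /mpinv -mulmxA mulVmx // gram_unit. Qed.

Lemma mulmx_mpinvK k (u : 'M[R]_(k, m)) : u *m p *m a = u.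
Proof. by rewrite -mulmxA mpinvK mulmx1. Qed.

Lemma invmx_gram_sym : (invmx (gram a))^T = invmx (gram a).
Proof. by rewrite trmx_inv gram_sym. Qed.

Lemma mpinv_tr : p^T = a *m invmx (gram a).
Proof. by rewrite trmx_mul trmxK invmx_gram_sym. Qed.

Lemma mpinvE b : mpinv b = invmx (gram b) *m b^T :> 'M[R]_(m, n).
Proof. by []. Qed.

Lemma mpinv_mul_tr : p *m p^T = invmx (gram a).
Proof. by rewrite mpinv_tr mulmxA mpinvK mul1mx. Qed.

Lemma proj_sym : P^T = P.
Proof. by rewrite trmx_mul mpinv_tr mulmxA. Qed.

Lemma proj_idem : P *m P = P.
Proof. by rewrite mulmxA mulmx_mpinvK. Qed.

Lemma mulmx_mpinv_proj k (u : 'M[R]_(k, m)) : u *m p *m P = u *m p.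
Proof. by rewrite mulmxA -(mulmxA u) mpinvK mulmx1. Qed.

Lemma mxtrace_proj : \tr P = m%:R.
Proof. by rewrite mxtrace_mulC mpinvK mxtrace1. Qed.

(** The factor p p^T is the inverse of the Gram matrix, so the metric is the
    Frobenius product of U = u a^+ and V = v a^+. *)
Lemma metricE u v : metric a u v = \tr ((u *m p) *m (v *m p)^T) * vol a.
Proof.
by rewrite /metric mulmx_mul_tr mpinv_mul_tr.
Qed.

Lemma metric_sym u v : metric a u v = metric a v u.
Proof. by rewrite !metricE mxtrace_trC. Qed.

Lemma metric_addl u1 u2 v : metric a (u1 + u2) v = metric a u1 v + metric a u2 v.
Proof. by rewrite /metric !mulmxDl mxtraceD mulrDl. Qed.

Lemma metric_oppl u v : metric a (- u) v = - metric a u v.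
Proof. by rewrite /metric !mulNmx raddfN mulNr. Qed.

Lemma metric_nondeg u : (forall v, metric a u v = 0) -> u = 0.
Proof.
move=> /(_ u); rewrite metricE => /eqP.
rewrite mulf_eq0 (gt_eqF (vol_gt0 ra)) orbF => /eqP/frob_eq0 U0.
by rewrite -(mulmx_mpinvK u) U0 mul0mx.
Qed.

Lemma is_derive_gram w : is_derive a w gram (w^T *m a + a^T *m w).
Proof.
have H := is_derive_id a w.
exact: is_derive_mulmx (is_derive_trmx H) H.
Qed.

Lemma near_gram_unit : \forall b \near a, gram b \in unitmx.
Proof. by apply: near_Mplus ra _ => b; exact: gram_unit. Qed.

(** The factor p p^T is the inverse of the Gram matrix. *)
Lemma is_derive_mpinv w :
  is_derive a w mpinv (p *m p^T *m w^T *m (1%:M - P) - p *m w *m p).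
Proof.
have H := is_derive_id a w.
have Hi := is_derive_invmx near_gram_unit (is_derive_gram w).
have Hp := is_derive_ext (fun b => esym (mpinvE b))
             (is_derive_mulmx Hi (is_derive_trmx H)).
apply: is_derive_eq Hp _ => /=.
rewrite mpinv_mul_tr mpinvE mulmxDr mulmxDl mulNmx mulmxDl.
rewrite mulmxBr mulmx1 !mulmxA opprD.
by rewrite addrC addrA.
Qed.

(** Jacobi's formula with the adjugate written as determinant times inverse; both
    halves of the derivative of the Gram matrix contribute tr W, which cancels the
    factor 1/2 from the square root. *)
Lemma is_derive_vol w : is_derive a w vol (vol a * \tr (w *m p)).
Proof.
have Hd := is_derive_det (is_derive_gram w).
have Hs := is_derive_sqrt (f := fun b => \det (gram b)) (det_gram_gt0 ra) Hd.
apply: is_derive_eq (is_derive_ext (fun b => erefl (vol b)) Hs) _.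
have Gu := gram_unit ra.
have -> : \adj (gram a) = \det (gram a) *: invmx (gram a).
  by rewrite /invmx Gu scalerA mulrV ?scale1r.
rewrite -scalemxAr mxtraceZ -/(vol a) mulmxDl mxtraceD.
have -> : \tr (w^T *m a *m invmx (gram a)) = \tr (w *m p).
  by rewrite -mxtrace_tr !trmx_mul trmxK invmx_gram_sym mulmxA mxtrace_mulC.
have -> : \tr (a^T *m w *m invmx (gram a)) = \tr (w *m p).
  by rewrite mxtrace_mulC mulmxA mxtrace_mulC.
have v0 := vol_gt0 ra.
have {1}-> : \det (gram a) = vol a ^+ 2 by rewrite sqr_sqrtr // ltW // det_gram_gt0.
by field; rewrite gt_eqF.
Qed.

Lemma is_derive_lift u w :
  is_derive a w (fun b => u *m mpinv b) (lift_diff P (w *m p) (u *m p)).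
Proof.
apply: is_derive_eq (is_derive_mulmx (is_derive_cst u a w) (is_derive_mpinv w)) _.
by rewrite mul0mx add0r lift_variation.
Qed.

Lemma is_derive_metric u v w :
  let U := u *m p in let V := v *m p in let W := w *m p in
  is_derive a w (fun b => metric b u v)
   ((\tr W * \tr (U *m V^T) - \tr (U *m (W + W^T) *m V^T)) * vol a).
Proof.
move=> U V W.
have Hi := is_derive_invmx near_gram_unit (is_derive_gram w).
have H1 := is_derive_mulmx (is_derive_mulmx (is_derive_cst u a w) Hi)
             (is_derive_cst v^T a w).
apply: is_derive_eq (is_derive_mulr (is_derive_mxtrace H1) (is_derive_vol w)) _.
rewrite -!mpinv_mul_tr mul0mx add0r mulmx0 addr0 /=.
have -> : u *m (p *m p^T) *m v^T = U *m V^T.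
  by rewrite mulmx_mul_tr.
have -> : u *m - (p *m p^T *m (w^T *m a + a^T *m w) *m (p *m p^T)) *m v^T
   = - (U *m (W + W^T) *m V^T).
  rewrite mulmxN mulNmx metric_variation proj_sym !mulmx_mpinv_proj.
  by rewrite addrC -mulmxDl -mulmxDr.
rewrite raddfN /=; ring.
Qed.

End MoorePenrose.

(** * The Levi-Civita connection and its curvature *)

Section CstRules.
Context {R : realType} {V : normedModType R} (a v : V).

Lemma is_derive_mulmx_cstr m n q (M : V -> 'M[R]_(m, n)) (N : 'M[R]_(n, q)) dM :
  is_derive a v M dM -> is_derive a v (fun x => M x *m N) (dM *m N).
Proof.
move=> Md; apply: is_derive_eq (is_derive_mulmx Md (is_derive_cst N a v)) _.
by rewrite mulmx0 addr0.
Qed.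

Lemma is_derive_scalemx_cstr m n (f : V -> R) (N : 'M[R]_(m, n)) df :
  is_derive a v f df -> is_derive a v (fun x => f x *: N) (df *: N).
Proof.
move=> fd; apply: is_derive_eq (is_derive_scalemx fd (is_derive_cst N a v)) _.
by rewrite scaler0 addr0.
Qed.
End CstRules.

Lemma sum_swap (V : zmodType) (x y t A B C D E : V) :
  x + y - t - A - B - C + D + E = y + x - t - B - A - C + E + D.
Proof. by rewrite (addrC x) (addrAC _ (- A)) (addrAC _ D). Qed.

Section ChristoffelForm.
Context {R : realType} {n m : nat}.
Implicit Types (u v w a : 'M[R]_(n, m)) (p : 'M[R]_(m, n)) (dU dV : 'M[R]_n).

(** The Christoffel form, written so that it depends on a and p through products and
    traces only; this is the form that is differentiated. *)
Definition christoffel_expr a p u v : 'M[R]_(n, m) :=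
  let U := u *m p in let V := v *m p in
  2^-1 *: (\tr U *: v + \tr V *: u - \tr (U *m V^T) *: a - V *m u - U *m v
   - (V *m U^T + U *m V^T) *m a + U^T *m v + V^T *m u).

(** The product rule applied to the previous expression in the direction w, with dU
    and dV the derivatives of u p and v p. *)
Definition christoffel_expr_diff a p u v w dU dV : 'M[R]_(n, m) :=
  let U := u *m p in let V := v *m p in
  2^-1 *: (\tr dU *: v + \tr dV *: u
   - (\tr (dU *m V^T + U *m dV^T) *: a + \tr (U *m V^T) *: w)
   - dV *m u - dU *m v
   - ((dV *m U^T + V *m dU^T + (dU *m V^T + U *m dV^T)) *m a
       + (V *m U^T + U *m V^T) *m w)
   + dU^T *m v + dV^T *m u).

Lemma christoffel_expr_lift a p u v :
  christoffel_expr a p u v *m p = lifted_christoffel (a *m p) (u *m p) (v *m p).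
Proof.
rewrite /christoffel_expr /lifted_christoffel -scalemxAl; congr (_ *: _).
by rewrite !(mulmxDl, mulNmx) -!scalemxAl !mulmxA.
Qed.

Lemma christoffel_expr_diff_lift a p u v w :
  christoffel_expr_diff a p u v w (lift_diff (a *m p) (w *m p) (u *m p))
    (lift_diff (a *m p) (w *m p) (v *m p)) *m p
  = lifted_christoffel_diff (a *m p) (w *m p) (u *m p) (v *m p).
Proof.
rewrite /christoffel_expr_diff /lifted_christoffel_diff -scalemxAl; congr (_ *: _).
move: (lift_diff _ _ _) (lift_diff _ _ _) => dU1 dU2.
rewrite !(mulmxDl, mulNmx) -!scalemxAl.
by rewrite -!mulmxA.
Qed.

Lemma christoffel_expr_sym a p u v : christoffel_expr a p u v = christoffel_expr a p v u.
Proof.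
rewrite /christoffel_expr (mxtrace_trC (v *m p)) [v *m p *m (u *m p)^T + _]addrC.
by rewrite sum_swap.
Qed.
End ChristoffelForm.

Section LeviCivita.
Context {R : realType} {n m : nat}.
Implicit Types a u v w : 'M[R]_(n, m).

Definition levi_civita a u v := christoffel_expr a (mpinv a) u v.

Lemma is_christoffel_levi_civita a : Mplus a -> is_christoffel metric a (levi_civita a).
Proof.
move=> ra; split=> [u v|u v w]; first exact: christoffel_expr_sym.
rewrite (@derive_val _ _ _ _ _ _ _ (is_derive_metric ra u v w)).
rewrite 2!(metricE ra) -mulrDl.
rewrite /levi_civita (christoffel_expr_lift a _ w u) (christoffel_expr_lift a _ w v).
rewrite (@lifted_christoffel_compat _ _ (a *m mpinv a)) ?mulmx_mpinv_proj //.
exact: proj_sym.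
Qed.

(** The difference of two solutions gives a trilinear expression T that is symmetric in
    its first two arguments and antisymmetric in its last two. Permuting three
    arguments alternately by these rules returns T with the opposite sign, so T = 0
    and nondegeneracy applies. *)
Lemma is_christoffel_uniq a G1 G2 : Mplus a ->
  is_christoffel metric a G1 -> is_christoffel metric a G2 ->
  forall u v, G1 u v = G2 u v.
Proof.
move=> ra [s1 c1] [s2 c2] u v.
pose T w u v := metric a (G1 w u - G2 w u) v.
have Tsym w u' v' : T w u' v' = T u' w v' by rewrite /T s1 s2.
have Tanti w u' v' : T w u' v' = - T w v' u'.
  apply/eqP; rewrite -addr_eq0 /T !metric_addl !metric_oppl.
  have := c1 u' v' w; rewrite c2 (metric_sym ra u' (G1 _ _)) (metric_sym ra u' (G2 _ _)).
  by move=> E; apply/eqP; lra.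
apply/eqP; rewrite -subr_eq0; apply/eqP/(metric_nondeg ra) => w.
rewrite -/(T u v w).
have E1 := Tanti u v w; have E2 := Tsym u w v; have E3 := Tanti w u v.
have E4 := Tsym w v u; have E5 := Tanti v w u; have E6 := Tsym v u w.
lra.
Qed.

Lemma christoffelE a u v : Mplus a -> christoffel metric a u v = levi_civita a u v.
Proof.
move=> ra; apply: (is_christoffel_uniq ra); last exact: is_christoffel_levi_civita.
by apply: xgetPex; exists (levi_civita a); exact: is_christoffel_levi_civita.
Qed.

Lemma is_derive_levi_civita a u v w : Mplus a ->
  is_derive a w (fun b => levi_civita b u v)
    (christoffel_expr_diff a (mpinv a) u v w
       (lift_diff (a *m mpinv a) (w *m mpinv a) (u *m mpinv a))
       (lift_diff (a *m mpinv a) (w *m mpinv a) (v *m mpinv a))).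
Proof.
move=> ra.
have du := is_derive_lift ra u w; have dv := is_derive_lift ra v w.
have dut := is_derive_trmx du; have dvt := is_derive_trmx dv.
have da := is_derive_id a w.
apply: is_deriveZ; apply: is_deriveD; last exact: is_derive_mulmx_cstr dvt.
apply: is_deriveD; last exact: is_derive_mulmx_cstr dut.
apply: is_deriveB; last first.
  apply: is_derive_mulmx da.
  apply: is_deriveD; exact: is_derive_mulmx.
apply: is_deriveB; last exact: is_derive_mulmx_cstr du.
apply: is_deriveB; last exact: is_derive_mulmx_cstr dv.
apply: is_deriveB; last first.
  apply: is_derive_scalemx da.
  by apply: is_derive_mxtrace; apply: is_derive_mulmx.
apply: is_deriveD; apply: is_derive_scalemx_cstr; exact: is_derive_mxtrace.
Qed.

(** The formula for the connection holds on a neighbourhood of a, which is what allows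
    the first covariant derivative to be replaced before it is differentiated. *)
Lemma curvatureE a u v : Mplus a ->
  curvature metric a u v v =
  'D_u (fun b => levi_civita b v v) a - 'D_v (fun b => levi_civita b u v) a
  + levi_civita a u (levi_civita a v v) - levi_civita a v (levi_civita a u v).
Proof.
move=> ra.
have nablaE x y b : Mplus b ->
    nabla metric (fun _ => x) (fun _ => y) b = levi_civita b x y.
  by move=> rb; rewrite /nabla derive_cst add0r christoffelE.
have DE x y z : 'D_x (nabla metric (fun _ => y) (fun _ => z)) a =
    'D_x (fun b => levi_civita b y z) a.
  by apply: near_eq_derive; apply: near_Mplus ra _ => b; exact: nablaE.
have NN x y z : nabla metric (fun _ => x) (nabla metric (fun _ => y) (fun _ => z)) a
    = 'D_x (fun b => levi_civita b y z) a + levi_civita a x (levi_civita a y z).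
  by rewrite {1}/nabla DE christoffelE // nablaE.
have N0 : nabla metric (lie_bracket (fun _ => u) (fun _ => v)) (fun _ => v) a = 0.
  rewrite /nabla /lie_bracket !derive_cst subrr add0r christoffelE //.
  rewrite /levi_civita /christoffel_expr.
  rewrite !(mul0mx, trmx0, mulmx0, mxtrace0, scale0r, scaler0).
  by rewrite !(add0r, addr0, oppr0, mul0mx, scaler0).
by rewrite /curvature /riemann !NN N0 subr0 opprD addrACA addrA.
Qed.

Lemma metric_curvature a u v : Mplus a ->
  metric a (curvature metric a u v v) u =
  curvature_trace (a *m mpinv a) (u *m mpinv a) (v *m mpinv a) * vol a.
Proof.
move=> ra; rewrite (metricE ra) curvatureE //.
rewrite (@derive_val _ _ _ _ _ _ _ (is_derive_levi_civita v v u ra)).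
rewrite (@derive_val _ _ _ _ _ _ _ (is_derive_levi_civita u v v ra)).
have lift4 (A B C D : 'M[R]_(n, m)) q : (A - B + C - D) *m q =
    A *m q - B *m q + C *m q - D *m q :> 'M[R]_n.
  by rewrite mulmxDl mulNmx mulmxDl mulmxDl mulNmx.
rewrite lift4 2!christoffel_expr_diff_lift.
by rewrite /levi_civita 4!christoffel_expr_lift.
Qed.

End LeviCivita.

(** * Sectional curvature *)

Section Independence.
Context {R : realType} {V : vectType R}.
Implicit Types u v : V.

Lemma free2P u v :
  free [:: u; v] <-> forall x y, x *: u + y *: v = 0 -> x = 0 /\ y = 0.
Proof.
rewrite free_cons span_seq1 seq1_free; split=> [/andP[uv v0] x y E|indep].
  have [x0|xn0] := eqVneq x 0.
    split=> //; apply/eqP; move/eqP: E; rewrite x0 scale0r add0r scaler_eq0.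
    by rewrite (negPf v0) orbF.
  case/vlineP: uv; exists (- (x^-1 * y)).
  apply: (scalerI xn0); rewrite scalerA mulrN mulVKf // scaleNr.
  by apply/eqP; rewrite -addr_eq0 E.
apply/andP; split.
  apply/vlineP => -[k uE]; have [] := indep 1 (- k).
    by rewrite uE scale1r scaleNr subrr.
  by move/eqP; rewrite oner_eq0.
apply/eqP => v0; have [] := indep 0 1; first by rewrite v0 scale0r scaler0 addr0.
by move=> _ /eqP; rewrite oner_eq0.
Qed.
End Independence.

Section SectionalCurvature.
Context {R : realType} {n m : nat} (a : 'M[R]_(n, m)) (ra : Mplus a).
Implicit Types u v w : 'M[R]_(n, m).
Local Notation p := (mpinv a).
Local Notation P := (a *m p).
Local Notation tl u := (traceless a (u *m p)).

Lemma mulmx_width0 u (q : 'M[R]_(m, n)) : m = 0%N -> u *m q = 0.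
Proof.
move=> m0; apply/eqP; rewrite -mxrank_eq0 -leqn0 -[X in (_ <= X)%N]m0.
exact: leq_trans (mxrankM_maxl _ _) (rank_leq_col _).
Qed.

(** For m = 0 the division is by 0, but then all traces vanish. *)
Lemma mxtrace_lift u : \tr (u *m p) = \tr (u *m p) / m%:R * m%:R.
Proof.
have [m0|m0] := eqVneq m 0%N; last by rewrite divfK // pnatr_eq0.
by rewrite mulmx_width0 // mxtrace0 mul0r mul0r.
Qed.

Lemma curvature_formE u v :
  4 * metric a (curvature metric a u v v) u / vol a = curvature_form m%:R P (tl u) (tl v).
Proof.
rewrite metric_curvature // mulrA mulfK; last by rewrite gt_eqF // vol_gt0.
apply: curvature_traceE; rewrite ?mulmx_mpinv_proj -?mxtrace_lift //.
- exact: proj_sym.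
- exact: mxtrace_proj.
Qed.

Lemma gram_det_metric u v :
  metric a u u * metric a v v - metric a u v ^+ 2 =
  vol a ^+ 2 * (\tr ((u *m p) *m (u *m p)^T) * \tr ((v *m p) *m (v *m p)^T)
                - \tr ((u *m p) *m (v *m p)^T) ^+ 2).
Proof. by rewrite !(metricE ra); ring. Qed.

(** The map u |-> u a^+ is injective, so independent vectors remain independent and the
    strict Cauchy-Schwarz inequality applies to their images. *)
Lemma gram_det_metric_gt0 u v : free [:: u; v] ->
  0 < metric a u u * metric a v v - metric a u v ^+ 2.
Proof.
move=> /free2P indep; rewrite gram_det_metric; apply: mulr_gt0.
  by rewrite exprn_gt0 // vol_gt0.
rewrite subr_gt0; apply: frob_CauchySchwarz_lt => x y E; apply: indep.
have := congr1 (mulmx^~ a) E.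
by rewrite mul0mx mulmxDl -!scalemxAl !mulmx_mpinvK.
Qed.

Lemma sectionalE u v :
  sectional_curvature metric a u v =
  vol a / 4 / (metric a u u * metric a v v - metric a u v ^+ 2)
  * curvature_form m%:R P (tl u) (tl v).
Proof.
rewrite -curvature_formE /sectional_curvature.
have v0 : vol a != 0 by rewrite gt_eqF // vol_gt0.
move: (metric a (curvature _ _ _ _ _) _) ((_ - _)^-1) => N e.
by field.
Qed.

Lemma sectional_scale_gt0 u v : free [:: u; v] ->
  0 < vol a / 4 / (metric a u u * metric a v v - metric a u v ^+ 2).
Proof.
move=> uv; rewrite !divr_gt0 ?vol_gt0 //; exact: gram_det_metric_gt0.
Qed.

Lemma traceless_pure u : pure_trace a u -> tl u = 0.
Proof.
move=> [c ->]; rewrite /traceless -scalemxAl mxtraceZ mxtrace_proj //.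
have [m0|m0] := eqVneq m 0%N; last by rewrite mulfK ?subrr // pnatr_eq0.
by rewrite (mulmx_width0 _ _ m0) !scaler0 subrr.
Qed.

Lemma curvature_form0l k (Q V0 : 'M[R]_n) : curvature_form k Q 0 V0 = 0.
Proof.
rewrite /curvature_form /mxcomm !(trmx0, mulmx0, mul0mx, subrr, mxtrace0).
ring.
Qed.

Lemma curvature_form0r k (Q U0 : 'M[R]_n) : curvature_form k Q U0 0 = 0.
Proof.
rewrite /curvature_form /mxcomm !(trmx0, mulmx0, mul0mx, subrr, mxtrace0).
ring.
Qed.

Lemma sectional_pure u v : pure_trace a u \/ pure_trace a v ->
  sectional_curvature metric a u v = 0.
Proof.
rewrite sectionalE => -[] /traceless_pure ->.
  by rewrite curvature_form0l mulr0.
by rewrite curvature_form0r mulr0.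
Qed.

Lemma traceless_proj u : tl u *m P = tl u.
Proof. by rewrite /traceless mulmxBl -scalemxAl mulmx_mpinv_proj // proj_idem. Qed.

Lemma traceless_sym u : (u *m p)^T = u *m p -> (tl u)^T = tl u.
Proof.
by move=> us; rewrite /traceless [LHS]linearB /= [(_ *: _)^T]linearZ /= us proj_sym.
Qed.

Lemma mxcomm_sym (A B : 'M[R]_n) : A^T = A -> B^T = B -> (mxcomm A B)^T = - mxcomm A B.
Proof. by move=> As Bs; rewrite /mxcomm [LHS]linearB /= !trmx_mul As Bs opprB. Qed.

Lemma curvature_form_sym_traceless u v :
  (u *m p)^T = u *m p -> (v *m p)^T = v *m p ->
  curvature_form m%:R P (tl u) (tl v) =
  7 * \tr (mxcomm (tl v) (tl u) *m mxcomm (tl v) (tl u)) -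
  m%:R * (\tr (tl u *m (tl u)^T) * \tr (tl v *m (tl v)^T) - \tr (tl u *m (tl v)^T) ^+ 2).
Proof.
move=> us vs; rewrite (@curvature_form_sym _ _ m%:R P) ?traceless_proj ?traceless_sym //.
- exact: proj_sym.
- exact: proj_idem.
Qed.

Lemma sectional_horizontal_le0 u v : free [:: u; v] ->
  (u *m p)^T = u *m p -> (v *m p)^T = v *m p ->
  sectional_curvature metric a u v <= 0.
Proof.
move=> uv us vs; rewrite sectionalE pmulr_rle0 ?sectional_scale_gt0 //.
rewrite curvature_form_sym_traceless //.
have := mxtrace_sqr_antisym (mxcomm_sym (traceless_sym vs) (traceless_sym us)).
have := ler_wpM2l (ler0n R m) (frob_CauchySchwarz (tl u) (tl v)); lra.
Qed.

(** Independence of u and v modulo a is what makes the traceless parts independent: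
    a relation between these, multiplied by a, expresses a combination of u and v as
    a multiple of a. *)
Lemma sectional_horizontal_lt0 u v : (0 < m)%N ->
  (forall x y c, x *: u + y *: v = c *: a -> x = 0 /\ y = 0) ->
  (u *m p)^T = u *m p -> (v *m p)^T = v *m p ->
  sectional_curvature metric a u v < 0.
Proof.
move=> m0 indep us vs.
have uv : free [:: u; v].
  by apply/free2P => x y E; apply: (indep x y 0); rewrite E scale0r.
rewrite sectionalE pmulr_rlt0 ?sectional_scale_gt0 //.
rewrite curvature_form_sym_traceless //.
have := mxtrace_sqr_antisym (mxcomm_sym (traceless_sym vs) (traceless_sym us)).
have : \tr (tl u *m (tl v)^T) ^+ 2 < \tr (tl u *m (tl u)^T) * \tr (tl v *m (tl v)^T).
  apply: frob_CauchySchwarz_lt => x y E.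
  (* The trace parts that were removed from u and v add up to this multiple of a. *)
  apply: (indep x y (x * (\tr (u *m p) / m%:R) + y * (\tr (v *m p) / m%:R))).
  have := congr1 (mulmx^~ a) E.
  rewrite /traceless !scalerBr !scalerA mul0mx !(mulmxDl, mulNmx) -!scalemxAl.
  rewrite !mulmx_mpinvK // => /eqP.
  by rewrite addrACA -opprD -scalerDl subr_eq0 => /eqP.
have mR : 0 < m%:R :> R by rewrite ltr0n.
move=> CS; rewrite -subr_gt0 in CS; have := mulr_gt0 mR CS; lra.
Qed.

(** The vertical vectors w are those with W^T P + P W = 0. If U is symmetric then
    tr(U W^T) = tr(U W^T P) = - tr(U P W) = - tr(U W^T), so it is 0. Conversely
    w = (U - U^T) a is vertical, and its product with u is half of
    |U - U^T|^2 times the volume. *)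
Lemma horizontalP u : (u *m p)^T = u *m p <-> horizontal a u.
Proof.
have D w : 'D_w gram a = w^T *m a + a^T *m w.
  exact: (@derive_val _ _ _ _ _ _ _ (is_derive_gram a w)).
set U := u *m p.
have UP : U *m P = U by exact: mulmx_mpinv_proj.
have Ps := proj_sym a.
split=> [us w|hu].
  rewrite D => E; rewrite (metricE ra) -/U; set W := w *m p.
  have WP : W^T *m P + P *m W = 0.
    by rewrite -{2}Ps gram_variation E mulmx0 mul0mx.
  suff -> : \tr (U *m W^T) = 0 by rewrite mul0r.
  have PU : P *m U = U by rewrite -[in LHS]us -Ps -trmx_mul UP.
  have E1 : \tr (U *m W^T) = \tr (U *m (W^T *m P)).
    by rewrite -[in LHS]PU -mulmxA mxtrace_mulC -mulmxA.
  have E2 : \tr (U *m (P *m W)) = \tr (U *m W^T).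
    by rewrite mulmxA UP -mxtrace_tr trmx_mul us mxtrace_mulC.
  have := congr1 (fun M => \tr (U *m M)) WP.
  rewrite mulmxDr mulmx0 mxtrace0 mxtraceD -E1 E2; lra.
have PUt : P *m U^T = U^T by rewrite -[in RHS]UP [RHS]trmx_mul Ps.
pose w := (U - U^T) *m a.
have Wp : w *m p = U - U^T *m P.
  by rewrite /w -mulmxA mulmxBl UP.
have w0 : 'D_w gram a = 0.
  rewrite D /w trmx_mul [(_ - _)^T]linearB /= trmxK mulmxA -mulmxDl -mulmxDr.
  by rewrite addrC addrA subrK subrr mulmx0 mul0mx.
have := hu w w0; rewrite (metricE ra) -/U Wp => /eqP.
rewrite mulf_eq0 (gt_eqF (vol_gt0 ra)) orbF => /eqP E.
clear hu w0 Wp w; clearbody U; move: E.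
rewrite [(_ - _)^T]linearB /= trmx_mul trmxK Ps mulmxBr mulmxA UP raddfB /= => E.
suff : U - U^T = 0 by move/eqP; rewrite subr_eq0 => /eqP.
apply: frob_eq0.
rewrite [(_ - _)^T]linearB /= trmxK mulmxBr !mulmxBl !raddfB /=.
have E1 : \tr (U^T *m U) = \tr (U *m U^T) by rewrite mxtrace_mulC.
have E2 : \tr (U^T *m U^T) = \tr (U *m U) by rewrite -trmx_mul mxtrace_tr.
rewrite E1 E2; lra.
Qed.
End SectionalCurvature.

Section RankOne.
Context {R : realType} {n : nat}.

(** If P U = P V = 0 then U V = U P V = 0, and likewise all products of two of the
    matrices U and V vanish; so does U^T P. This kills all but the listed terms. *)
Lemma curvature_form_vertical (k : R) (P U V : 'M[R]_n) : P^T = P ->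
  U *m P = U -> V *m P = V -> P *m U = 0 -> P *m V = 0 ->
  curvature_form k P U V = 4 * \tr (V *m U^T *m (U *m V^T))
    - 2 * \tr (V *m V^T *m (U *m U^T))
    - 2 * \tr (V *m U^T *m (V *m U^T))
    - k * (\tr (U *m U^T) * \tr (V *m V^T) - \tr (U *m V^T) ^+ 2).
Proof.
move=> Ps UP VP PU PV.
have UtP : U^T *m P = 0 by rewrite -Ps -trmx_mul PU trmx0.
have VtP : V^T *m P = 0 by rewrite -Ps -trmx_mul PV trmx0.
have VU : V *m U = 0 by rewrite -VP -mulmxA PU mulmx0.
have UV : U *m V = 0 by rewrite -UP -mulmxA PV mulmx0.
have VV : V *m V = 0 by rewrite -[X in X *m _]VP -mulmxA PV mulmx0.
have VtUt : V^T *m U^T = 0 by rewrite -trmx_mul UV trmx0.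
rewrite /curvature_form.
have -> : mxcomm V U = 0 by rewrite /mxcomm VU UV subrr.
rewrite -(mulmxA _ _ P) UtP -(mulmxA _ _ P) VtP -(mulmxA _ _ P) UtP.
rewrite VU VV -(mulmxA V V^T U^T) VtUt -(mulmxA V^T V U) VU.
rewrite !(mul0mx, mulmx0, mxtrace0) -!mulmxA.
ring.
Qed.

Lemma mxtrace_outer (x y z w : 'cV[R]_n) :
  \tr (y *m x^T *m (z *m w^T)) = \tr (x *m z^T) * \tr (y *m w^T).
Proof.
rewrite -mulmxA (mulmxA x^T) [x^T *m z]mx11_scalar mul_scalar_mx -scalemxAr mxtraceZ.
congr (_ * _); rewrite mxtrace_trC mxtrace_mulC.
by rewrite /mxtrace big_ord1.
Qed.

(** With both matrices of rank one and with the same row q, the scalar q q^T factors out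
    of every product. The three quartic terms contribute 4 |x|^2 |y|^2 - 4 <x, y>^2,
    which explains the coefficient 4 - k. *)
Lemma curvature_form_rank1 (k : R) (P : 'M[R]_n) (x y : 'cV[R]_n) (q : 'rV[R]_n) :
  P^T = P -> q *m P = q -> P *m x = 0 -> P *m y = 0 ->
  curvature_form k P (x *m q) (y *m q) = (4 - k) * \tr (q *m q^T) ^+ 2 *
    (\tr (x *m x^T) * \tr (y *m y^T) - \tr (x *m y^T) ^+ 2).
Proof.
move=> Ps qP Px Py.
have xqP (z : 'cV[R]_n) : z *m q *m P = z *m q by rewrite -mulmxA qP.
have Pxq (z : 'cV[R]_n) : P *m z = 0 -> P *m (z *m q) = 0.
  by move=> Pz; rewrite mulmxA Pz mul0mx.
rewrite (curvature_form_vertical k Ps (xqP x) (xqP y) (Pxq x Px) (Pxq y Py)).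
set g := \tr (q *m q^T).
have outer (s t : 'cV[R]_n) : (s *m q) *m (t *m q)^T = g *: (s *m t^T).
  rewrite trmx_mul -mulmxA (mulmxA q) [q *m q^T]mx11_scalar mul_scalar_mx -scalemxAr.
  by rewrite /g /mxtrace big_ord1.
have tr2 (s t s' t' : 'cV[R]_n) : \tr ((g *: (s *m t^T)) *m (g *: (s' *m t'^T))) =
    g ^+ 2 * (\tr (t *m s'^T) * \tr (s *m t'^T)).
  by rewrite -scalemxAl -scalemxAr !mxtraceZ mxtrace_outer mulrA.
rewrite !outer !tr2 !mxtraceZ (mxtrace_trC y x).
ring.
Qed.
End RankOne.

Section Kernel.
Context {R : realType} {n m : nat} (a : 'M[R]_(n, m)) (ra : Mplus a).

(** The kernel of a^T has dimension n - m, which is at least 2; two vectors of a basis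
    are taken. *)
Lemma orthogonal_pair : (m + 2 <= n)%N ->
  exists x y : 'cV[R]_n, [/\ a^T *m x = 0, a^T *m y = 0 &
    forall s t, s *: x + t *: y = 0 -> s = 0 /\ t = 0].
Proof.
move=> mn; set K := kermx a; pose B := row_base K.
have rK : (1 < \rank K)%N by rewrite mxrank_ker (ra : \rank a = m) ltn_subRL -addnS.
have Ba : B *m a = 0 by apply/sub_kermxP; rewrite eq_row_base.
pose i0 := Ordinal (ltnW rK); pose i1 := Ordinal rK.
have orth i : a^T *m (row i B)^T = 0.
  by rewrite -trmx_mul -row_mul Ba row0 trmx0.
exists (row i0 B)^T, (row i1 B)^T; split=> // s t E.
have : s *: delta_mx 0 i0 + t *: delta_mx 0 i1 = 0 :> 'rV_(\rank K).
  apply: (row_free_inj (row_base_free K)); rewrite mul0mx mulmxDl -!scalemxAl -!rowE.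
  by apply: trmx_inj; rewrite trmx0 -E linearD /= !linearZ.
move=> /rowP H; have := H i0; have := H i1.
by rewrite !mxE !eqxx /= !(mulr1, mulr0) addr0 add0r => -> ->.
Qed.
End Kernel.

(** The difference of the two sides is the square of x0 y1 - x1 y0, and the line spanned
    by (a0, a1) kills that determinant. *)
Lemma planar_gram_scalar (R : realType) (a0 a1 x0 x1 y0 y1 : R) :
  (a0 != 0) || (a1 != 0) -> a0 * x0 + a1 * x1 = 0 -> a0 * y0 + a1 * y1 = 0 ->
  (x0 * x0 + x1 * x1) * (y0 * y0 + y1 * y1) = (x0 * y0 + x1 * y1) ^+ 2.
Proof.
move=> a_neq0 ax ay; apply/eqP; rewrite -subr_eq0.
rewrite (_ : _ - _ = (x0 * y1 - x1 * y0) ^+ 2); last by ring.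
rewrite expf_eq0 /=.
have E0 : a0 * (x0 * y1 - x1 * y0) = 0.
  rewrite (_ : _ * _ = (a0 * x0 + a1 * x1) * y1 - (a0 * y0 + a1 * y1) * x1); last by ring.
  by rewrite ax ay !mul0r subrr.
have E1 : a1 * (x0 * y1 - x1 * y0) = 0.
  rewrite (_ : _ * _ = (a0 * y0 + a1 * y1) * x0 - (a0 * x0 + a1 * x1) * y0); last by ring.
  by rewrite ax ay !mul0r subrr.
move/eqP: E0; move/eqP: E1; rewrite !mulf_eq0.
by case/orP: a_neq0 => /negPf -> // _.
Qed.

Lemma planar_gram (R : realType) (a x y : 'cV[R]_2) : a != 0 ->
  a^T *m x = 0 -> a^T *m y = 0 ->
  \tr (x *m x^T) * \tr (y *m y^T) = \tr (x *m y^T) ^+ 2.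
Proof.
move=> a0 /(congr1 (fun M : 'M[R]_1 => M 0 0)) ax /(congr1 (fun M : 'M[R]_1 => M 0 0)) ay.
rewrite !mxE !big_ord_recl !big_ord0 !mxE !addr0 in ax ay.
rewrite !mxtrace_mul_tr !big_ord_recl !big_ord0 !addr0.
apply: planar_gram_scalar ax ay; rewrite -negb_and.
apply: contra_neqN a0 => /andP[/eqP a00 /eqP a10].
apply/matrixP => i j; rewrite mxE ord1.
by case: (unliftP ord0 i) => [k|] ->; rewrite ?(ord1 k).
Qed.

Section Rank1.
Context {R : realType} {n : nat} (a : 'cV[R]_n) (ra : Mplus a).
Local Notation p := (mpinv a).
Local Notation P := (a *m p).

(** For m = 1 removing the trace part of u amounts to projecting u orthogonally to a. *)
Definition normal_part (u : 'cV[R]_n) : 'cV[R]_n := u - (\tr (u *m p) / 1%:R) *: a.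

Lemma traceless_line u : traceless a (u *m p) = normal_part u *m p.
Proof. by rewrite /traceless /normal_part mulmxBl -scalemxAl. Qed.

Lemma proj_normal_part u : P *m normal_part u = 0.
Proof.
rewrite /normal_part mulmxBr -scalemxAr mulmx_mpinvK // divr1 mxtrace_mulC -mulmxA.
by rewrite [p *m u]mx11_scalar mul_mx_scalar mxtrace_scalar mulr1n subrr.
Qed.

Lemma tr_mul_proj : a^T *m P = a^T.
Proof. by rewrite -[RHS](congr1 trmx (mulmx_mpinvK ra a)) [RHS]trmx_mul proj_sym. Qed.

Lemma tr_normal_part u : a^T *m normal_part u = 0.
Proof. by rewrite -tr_mul_proj -mulmxA proj_normal_part mulmx0. Qed.

Lemma sectional_line u v :
  sectional_curvature metric a u v =
  vol a / 4 / (metric a u u * metric a v v - metric a u v ^+ 2) *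
  (3 * \tr (p *m p^T) ^+ 2 *
    (\tr (normal_part u *m (normal_part u)^T) * \tr (normal_part v *m (normal_part v)^T)
      - \tr (normal_part u *m (normal_part v)^T) ^+ 2)).
Proof.
rewrite sectionalE // !traceless_line curvature_form_rank1 ?proj_normal_part ?proj_sym //.
  by congr (_ * (_ * _ * _)); ring.
by rewrite mulmxA mpinvK // mul1mx.
Qed.

Lemma sectional_line_ge0 u v : free [:: u; v] ->
  0 <= sectional_curvature metric a u v.
Proof.
move=> uv; rewrite sectional_line pmulr_rge0 ?sectional_scale_gt0 //.
rewrite mulr_ge0 //; first by rewrite mulr_ge0 // sqr_ge0.
by rewrite subr_ge0 frob_CauchySchwarz.
Qed.
End Rank1.

(** In the plane the orthogonal complement of a is a line, so the normal parts of u and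
    v are dependent. *)
Lemma sectional_plane (R : realType) (a u v : 'cV[R]_2) : Mplus a ->
  sectional_curvature metric a u v = 0.
Proof.
move=> ra; rewrite sectional_line //.
rewrite (@planar_gram _ a) ?tr_normal_part ?subrr ?mulr0 //.
by rewrite -mxrank_eq0 (ra : \rank a = 1%N).
Qed.

Section BothSigns.
Context {R : realType} {n m : nat} (a : 'M[R]_(n, m)) (ra : Mplus a).
Local Notation p := (mpinv a).
Local Notation P := (a *m p).

(** The planes used are spanned by x d and y d with d a coordinate row and x, y
    independent and orthogonal to the columns of a. *)
Lemma exists_positive : (0 < m < 4)%N -> (m + 2 <= n)%N ->
  exists u v : 'M[R]_(n, m), free [:: u; v] /\ 0 < sectional_curvature metric a u v.
Proof.
move=> /andP[m0 m4] mn; have [x [y [ax ay indep]]] := orthogonal_pair ra mn.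
pose d : 'rV[R]_m := delta_mx 0 (Ordinal m0); pose q := d *m p.
have dd : d *m d^T = 1%:M.
  rewrite /d trmx_delta mul_delta_mx; apply/matrixP => i j.
  by rewrite !mxE !ord1.
have ppos z : a^T *m z = 0 -> p *m z = 0 :> 'cV[R]_m.
  by move=> az; rewrite mpinvE -mulmxA az mulmx0.
have uv : free [:: x *m d; y *m d].
  apply/free2P => s t E; apply: indep.
  have := congr1 (mulmx^~ d^T) E.
  by rewrite mul0mx mulmxDl -!scalemxAl -!mulmxA dd !mulmx1.
have tl z : a^T *m z = 0 -> traceless a (z *m d *m p) = z *m q.
  move=> /ppos pz; rewrite /traceless -mulmxA -/q.
  by rewrite mxtrace_mulC -mulmxA pz mulmx0 mxtrace0 mul0r scale0r subr0.
have Pz z : a^T *m z = 0 -> P *m z = 0 :> 'cV[R]_n.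
  by move=> /ppos pz; rewrite -mulmxA pz mulmx0.
have qP : q *m P = q by rewrite mulmx_mpinv_proj.
exists (x *m d), (y *m d); split=> //.
rewrite sectionalE // pmulr_rgt0 ?sectional_scale_gt0 // !tl //.
rewrite curvature_form_rank1 ?Pz ?proj_sym //.
have q0 : q != 0.
  apply/eqP => q0; have : q *m a = d by rewrite /q mulmx_mpinvK.
  rewrite q0 mul0mx => d0; have := dd; rewrite -d0 mul0mx => /matrixP/(_ 0 0).
  by rewrite !mxE eqxx => /esym/eqP; rewrite oner_eq0.
apply: mulr_gt0; last by rewrite subr_gt0; exact: frob_CauchySchwarz_lt.
apply: mulr_gt0; first by rewrite subr_gt0 ltr_nat.
by rewrite exprn_gt0 // frob_gt0.
Qed.

Lemma gram_diag_neq0 j : gram a j j != 0.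
Proof.
apply/eqP => G0; have : \tr (row j a^T *m (row j a^T)^T) = 0.
  rewrite /mxtrace big_ord1 mxE -[RHS]G0 [in RHS]mxE.
  by apply: eq_bigr => k _; rewrite !mxE.
move=> /frob_eq0 r0; have aT_free : row_free a^T by rewrite /row_free mxrank_tr ra.
have : delta_mx 0 j *m a^T = 0 *m a^T :> 'rV_n by rewrite -rowE r0 mul0mx.
move=> /(row_free_inj aT_free)/rowP/(_ j).
by rewrite !mxE !eqxx => /eqP; rewrite oner_eq0.
Qed.

(** Vectors of the form p^T S with S symmetric are horizontal, and a itself is p^T
    times the Gram matrix. The Gram matrix has nonzero diagonal entries, so it is
    independent of two symmetric matrices that vanish at a diagonal place. *)
Lemma exists_negative : (1 < m)%N ->
  exists u v : 'M[R]_(n, m), free [:: u; v] /\ sectional_curvature metric a u v < 0.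
Proof.
move=> m1; pose j0 := Ordinal (ltnW m1); pose j1 := Ordinal m1.
pose S : 'M[R]_m := delta_mx j0 j0.
pose T : 'M[R]_m := delta_mx j0 j1 + delta_mx j1 j0.
have indep x y c : x *: (p^T *m S) + y *: (p^T *m T) = c *: a -> x = 0 /\ y = 0.
  move=> E; have apT : a^T *m p^T = 1%:M by rewrite -trmx_mul mpinvK // trmx1.
  have := congr1 (mulmx a^T) E.
  rewrite mulmxDr -!scalemxAr !mulmxA apT !mul1mx -/(gram a).
  move: (gram a) (gram_diag_neq0 j1) => G G11 /matrixP H.
  have := H j1 j1; have := H j0 j0; have := H j0 j1.
  rewrite !mxE !eqxx /= !(mulr0, mulr1, addr0, add0r, mulr0n, mulr1n).
  move=> E01 E00 /esym/eqP; rewrite mulf_eq0 (negPf G11) orbF => /eqP c0.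
  by move: E01 E00; rewrite c0 !mul0r.
have sym (q : 'M[R]_(m, n)) (M : 'M[R]_m) : M^T = M ->
    (q^T *m M *m q)^T = q^T *m M *m q.
  by move=> Ms; rewrite !trmx_mul trmxK Ms mulmxA.
have Ss : S^T = S by rewrite trmx_delta.
have Ts : T^T = T by rewrite [LHS]linearD /= !trmx_delta addrC.
exists (p^T *m S), (p^T *m T); split.
  by apply/free2P => x y E; apply: (indep x y 0); rewrite E scale0r.
by apply: sectional_horizontal_lt0 indep (sym p S Ss) (sym p T Ts) => //; exact: ltnW.
Qed.
End BothSigns.

Theorem theorem3p10 (R : realType) (n m : nat) (le_mn : (m <= n)%N) :
  (forall a u v : 'M[R]_(n, m),
     Mplus a -> orthonormal_pair metric a u v ->
     let P := a *m mpinv a in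
     let U0 := traceless a (u *m mpinv a) in
     let V0 := traceless a (v *m mpinv a) in
     4 * sectional_curvature metric a u v / vol a
       = 4 * metric a (curvature metric a u v v) u / vol a
     /\
     4 * metric a (curvature metric a u v v) u / vol a
       = 2 * \tr (mxcomm V0 U0 *m mxcomm V0^T U0)
         + 2 * \tr (mxcomm V0 U0^T *m mxcomm V0 U0)
         + 2 * \tr (V0 *m U0 *m V0^T *m U0^T)
         + \tr (V0 *m V0^T *m U0^T *m U0)
         - 4 * \tr (V0 *m V0 *m U0^T *m U0^T)
         + 4 * \tr (V0 *m U0^T *m U0 *m V0^T)
         + \tr (V0^T *m V0 *m U0 *m U0^T)
         - 2 * \tr (V0 *m V0^T *m U0 *m U0^T)
         - 2 * \tr (V0 *m U0^T *m V0 *m U0^T)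
         + 6 * \tr (V0 *m U0^T *m V0 *m U0^T *m P)
         - 3 * \tr (V0 *m U0^T *m U0 *m V0^T *m P)
         - 3 * \tr (U0 *m V0^T *m V0 *m U0^T *m P)
         - m%:R * \tr (V0 *m V0^T) * \tr (U0 *m U0^T)
         + m%:R * \tr (U0 *m V0^T) ^+ 2)
  /\
  (* (1) *)
  (forall a u v : 'M[R]_(n, m),
     Mplus a -> free [:: u; v] -> pure_trace a u \/ pure_trace a v ->
     sectional_curvature metric a u v = 0)
  /\
  (* (2) *)
  ((2 <= m)%N ->
   (forall a u : 'M[R]_(n, m),
      Mplus a -> ((u *m mpinv a)^T = u *m mpinv a <-> horizontal a u))
   /\
   (forall a u v : 'M[R]_(n, m),
      Mplus a -> free [:: u; v] ->
      (u *m mpinv a)^T = u *m mpinv a -> (v *m mpinv a)^T = v *m mpinv a ->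
      sectional_curvature metric a u v <= 0
      /\
      (a \notin <<[:: u; v]>>%VS -> sectional_curvature metric a u v < 0)))
  /\
  (* (3) *)
  (m = 1%N ->
   (forall a u v : 'M[R]_(n, m),
      Mplus a -> free [:: u; v] -> 0 <= sectional_curvature metric a u v)
   /\
   (n = 2%N ->
    forall a u v : 'M[R]_(n, m),
      Mplus a -> free [:: u; v] -> sectional_curvature metric a u v = 0))
  /\
  (* (4) *)
  (m = 2%N \/ m = 3%N -> (m + 2 <= n)%N ->
   forall a : 'M[R]_(n, m), Mplus a ->
     (exists u v : 'M[R]_(n, m),
        free [:: u; v] /\ 0 < sectional_curvature metric a u v)
     /\
     (exists u v : 'M[R]_(n, m),
        free [:: u; v] /\ sectional_curvature metric a u v < 0)).
Proof.
split=> [a u v ra [uu vv uv] P U0 V0|].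
  split; last exact: curvature_formE.
  by rewrite /sectional_curvature uu vv uv expr0n subr0 mulr1 divr1.
split=> [a u v ra _|]; first exact: sectional_pure.
split=> [m2|].
  split=> [a u ra|a u v ra uv us vs]; first exact: horizontalP.
  split=> [|aNuv]; first exact: sectional_horizontal_le0.
  apply: sectional_horizontal_lt0 us vs => [//||x y c E]; first exact: ltnW.
  have /free2P indep := uv.
  have [c0|cN0] := eqVneq c 0; first by apply: indep; rewrite E c0 scale0r.
  case/negP: aNuv; rewrite -[a](scalerK cN0) -E memvZ // memvD // memvZ // memv_span //.
    by rewrite mem_head.
  by rewrite !inE eqxx orbT.
split=> [m1|m23 mn a ra].
  subst m; split=> [a u v ra|n2]; first exact: sectional_line_ge0.
  by subst n => a u v ra _; exact: sectional_plane.
split; first by apply: exists_positive => //; case: m23 => ->.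
by apply: exists_negative => //; case: m23 => ->.
Qed.
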